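(* Let $F$ be a field of characteristic $2$, and let $p$ and $q$ be anisotropic quasilinear quadratic forms of dimension $\geq 2$ over $F$ such that $q_{F(p)}$ is isotropic. If $\mathfrak{i}_0(q_{F(p)}) > \dim(q) - \dim(p)$, then $2^{\mathfrak{d}_1(p)} \geq \mathfrak{i}_0(q_{F(p)})$; that is, $p_1$ is divisible by a quasi-Pfister form of dimension $\geq \mathfrak{i}_0(q_{F(p)})$.
   Context: Quasilinear form (char $2$): an additive quadratic form, equivalently $\langle a_1,\dots,a_n\rangle:(\lambda_i)\mapsto\sum a_i\lambda_i^2$; $\langle a_i\rangle\otimes\langle b_j\rangle\simeq\langle a_ib_j\rangle$. $\mathfrak{i}_0(\phi)$ is the maximal dimension of a totally isotropic subspace; the anisotropic part $\phi_{\mathrm{an}}$ is the induced form on $V_\phi/U$, $U$ the subspace of isotropic vectors. $F(p)$ is the function field of the projective quadric $\{p=0\}$; $p_1:=(p_{F(p)})_{\mathrm{an}}$. An $s$-fold quasi-Pfister form is $\langle 1,a_1\rangle\otimes\cdots\otimes\langle1,a_s\rangle$ ($a_i$ nonzero; the $0$-fold one is $\langle1\rangle$). A form $\phi$ is divisible by $\pi$ if $\phi\simeq\pi\otimes r$ for some form $r$. The divisibility index $\mathfrak{d}_0(\phi)$ is the largest $s\ge0$ such that $\phi_{\mathrm{an}}$ is divisible by an $s$-fold quasi-Pfister form, and $\mathfrak{d}_1(p):=\mathfrak{d}_0(p_1)$. *)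

(* Defs.v *)
From HB Require Import structures.
From mathcomp Require Import all_boot all_order all_algebra.
From mathcomp Require Import boolp.
From mathcomp Require Import mpoly.

Set Implicit Arguments.
Unset Strict Implicit.
Unset Printing Implicit Defensive.

Import GRing.Theory.
Local Open Scope ring_scope.

(* A quasilinear form <a_1, ..., a_n> over F is the sequence of its
   coefficients; its dimension is the size of the sequence.  Zero coefficients
   are allowed.  By [additive_form_diag] below, every additive quadratic form
   on F^n arises in this way. *)
Definition qlform (F : fieldType) : Type := seq F.

Section QuasilinearForms.
Variable F : fieldType.
Implicit Types (phi psi pi r : qlform F).

Definition qldim phi : nat := size phi.

Definition qleval phi (v : 'rV[F]_(qldim phi)) : F :=
  \sum_(i < qldim phi) nth 0 phi i * v 0 i ^+ 2.

Definition isotropic phi : Prop :=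
  exists2 v : 'rV[F]_(qldim phi), v != 0 & qleval v = 0.

Definition anisotropic phi : Prop := ~ isotropic phi.

Definition isometric phi psi : Prop :=
  exists f : {linear 'rV[F]_(qldim phi) -> 'rV[F]_(qldim psi)},
    bijective f /\ forall v, qleval (f v) = qleval v.

Definition tensor phi psi : qlform F := [seq a * b | a <- phi, b <- psi].

Definition divisible phi pi : Prop := exists r, isometric phi (tensor pi r).

Definition quasi_pfister (s : seq F) : qlform F :=
  foldr (fun a pi => tensor [:: 1; a] pi) [:: 1] s.

Definition is_quasi_pfister (s : nat) pi : Prop :=
  exists2 a : s.-tuple F, (forall i, tnth a i != 0) & pi = quasi_pfister a.

Definition totally_isotropic phi (U : {vspace 'rV[F]_(qldim phi)}) : Prop :=
  forall v, v \in U -> qleval v = 0.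

Definition iso_index phi : nat :=
  \max_(k < (qldim phi).+1 |
        `[< exists2 U, @totally_isotropic phi U & \dim U = k >]) k.

(* [psi] is the form induced by [phi] on V_phi/U, with U the set of isotropic
   vectors: the quotient V_phi/U is presented by a surjective linear map out
   of V_phi with kernel U. *)
Definition is_anisotropic_part phi psi : Prop :=
  exists f : {linear 'rV[F]_(qldim phi) -> 'rV[F]_(qldim psi)},
    [/\ forall w, exists v, f v = w,
        forall v, f v = 0 <-> qleval v = 0
      & forall v, qleval (f v) = qleval v].

(* Determined up to isometry; the default value is never used in
   characteristic 2, see [anisotropic_partP]. *)
Definition anisotropic_part phi : qlform F :=
  if pselect (exists psi, is_anisotropic_part phi psi) is left ex_psi
  then projT1 (cid ex_psi) else [::].

(* If [phi] is not identically zero, then 2 ^ s divides the dimension of its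
   anisotropic part whenever [s] occurs, so the bound on [s] is harmless.  If
   [phi] is zero, then all [s] occur in the unbounded set and the index is not
   meaningful. *)
Definition div_index phi : nat :=
  \max_(s < (qldim phi).+1 |
        `[< exists2 pi, is_quasi_pfister s pi
                      & divisible (anisotropic_part phi) pi >]) s.

End QuasilinearForms.

Definition base_change (F K : fieldType) (iota : F -> K) (phi : qlform F) :
  qlform K := map iota phi.

Definition qlpoly (F : fieldType) (phi : qlform F) : {mpoly F[qldim phi]} :=
  \sum_(i < qldim phi) nth 0 phi i *: 'X_i ^+ 2.

(* [iota : F -> K] is the function field of the integral projective quadric
   Proj F[T_1, ..., T_n]/(p): some field L contains the homogeneous coordinate
   ring F[T_1, ..., T_n]/(p), with x_i the image of T_i, and K is the subfield
   of L formed by the fractions f(x)/g(x) with f and g homogeneous of the same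
   degree and g(x) nonzero. *)
Definition is_function_field (F : fieldType) (p : qlform F) (K : fieldType)
    (iota : {rmorphism F -> K}) : Prop :=
  exists (L : fieldType) (j : {rmorphism K -> L}) (x : 'I_(qldim p) -> L),
    let ev (f : {mpoly F[qldim p]}) : L := mmap (j \o iota) x f in
    (forall f, ev f = 0 <-> exists g, f = g * qlpoly p) /\
    (forall z : L, (exists y : K, j y = z) <->
       exists (d : nat) (f g : {mpoly F[qldim p]}),
         [/\ f \is d.-homog, g \is d.-homog, ev g != 0 & z = ev f / ev g]).

Definition form1 (F K : fieldType) (iota : F -> K) (p : qlform F) : qlform K :=
  anisotropic_part (base_change iota p).

Definition div_index1 (F K : fieldType) (iota : F -> K) (p : qlform F) : nat :=
  div_index (form1 iota p).

Section Facts.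
Variable F : fieldType.

Lemma additive_form_diag n (h : 'rV[F]_n -> F) :
  (forall u v, h (u + v) = h u + h v) ->
  (forall a v, h (a *: v) = a ^+ 2 * h v) ->
  forall v, h v = \sum_(i < n) h (delta_mx 0 i) * v 0 i ^+ 2.
Proof.
move=> hD hZ v; have h0 : h 0 = 0 by rewrite -(scale0r 0) hZ expr0n mul0r.
rewrite {1}(row_sum_delta v) (big_morph h hD h0).
by apply: eq_bigr => i _; rewrite hZ mulrC.
Qed.

Hypothesis char2 : 2%N \in [pchar F].
Variable phi : qlform F.

Lemma qlevalD (u v : 'rV[F]_(qldim phi)) : qleval (u + v) = qleval u + qleval v.
Proof.
rewrite /qleval -big_split; apply: eq_bigr => i _ /=.
by rewrite mxE -!(pFrobenius_autE char2) rmorphD mulrDr.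
Qed.

Lemma qlevalZ a (v : 'rV[F]_(qldim phi)) : qleval (a *: v) = a ^+ 2 * qleval v.
Proof.
rewrite /qleval mulr_sumr; apply: eq_bigr => i _.
by rewrite mxE exprMn mulrCA.
Qed.

Lemma isotropic_vspace :
  exists U : {vspace 'rV[F]_(qldim phi)}, forall v, (v \in U) = (qleval v == 0).
Proof.
have ev0 : qleval (0 : 'rV[F]_(qldim phi)) = 0.
  by rewrite -(scale0r 0) qlevalZ expr0n mul0r.
pose P k := `[< exists2 U, @totally_isotropic _ phi U & \dim U = k >].
have P0 : exists k, P k.
  exists 0%N; apply/asboolP; exists 0%VS; last exact: dimv0.
  by move=> v; rewrite memv0 => /eqP ->.
have Pub k : P k -> (k <= \dim {:'rV[F]_(qldim phi)})%N.
  by move=> /asboolP[U _ <-]; rewrite dimvS ?subvf.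
case: (ex_maxnP P0 Pub) => k /asboolP[U Uiso dimU] kmax.
exists U => v; apply/idP/eqP => [/Uiso //|v0].
have : P (\dim (U + <[v]>)).
  apply/asboolP; exists (U + <[v]>)%VS => // w.
  by move=> /memv_addP[u uU [_ /vlineP[a ->] ->]]; rewrite qlevalD qlevalZ v0
    mulr0 addr0 Uiso.
move=> /kmax; rewrite -dimU => dimle.
have /eqP UE : (U == U + <[v]>)%VS by rewrite eqEdim addvSl.
by rewrite UE memvE addvSr.
Qed.

Lemma anisotropic_partP : is_anisotropic_part phi (anisotropic_part phi).
Proof.
rewrite /anisotropic_part; case: pselect => [ex_psi|[]]; first by case: cid.
have [U UP] := isotropic_vspace.
pose W := (U^C)%VS; pose X := vbasis W; pose psi : qlform F := map (@qleval F phi) X.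
have szp : size psi = \dim W by rewrite size_map size_tuple.
have UW : (U + W)%VS = fullv by exact: addv_complf.
have UWc : (W :&: U)%VS = 0%VS by rewrite capvC capv_compl.
pose f (v : 'rV[F]_(qldim phi)) : 'rV[F]_(qldim psi) :=
  \row_i coord X (cast_ord szp i) (daddv_pi W U v).
have flin : linear f.
  by move=> a u v; apply/rowP => i; rewrite !mxE !linearP.
pose fL := GRing.isLinear.Build _ _ _ _ f flin.
pose g : {linear 'rV[F]_(qldim phi) -> 'rV[F]_(qldim psi)} :=
  HB.pack f fL.
have decE v : exists2 u, u \in U & v = daddv_pi W U v + u.
  exists (daddv_pi U W v); first exact: memv_pi.
  by rewrite daddv_pi_add // addvC UW memvf.
have evE v : qleval (daddv_pi W U v) = qleval v.
  have [u uU vE] := decE v; have /esym := congr1 (@qleval _ _) vE.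
  by rewrite qlevalD; move: uU; rewrite UP => /eqP ->; rewrite addr0.
have ev_sum (c : 'I_(\dim W) -> F) :
    qleval (\sum_(i < \dim W) c i *: X`_i) = \sum_(i < \dim W) qleval (X`_i : 'rV[F]_(qldim phi)) * c i ^+ 2.
  have ev0 : qleval (0 : 'rV[F]_(qldim phi)) = 0.
    by rewrite -(scale0r 0) qlevalZ expr0n mul0r.
  rewrite (big_morph _ qlevalD ev0).
  by apply: eq_bigr => i _; rewrite qlevalZ mulrC.
have evg v : qleval (g v) = qleval v.
  rewrite -[RHS]evE [in RHS](coord_vbasis (memv_pi W U v)) ev_sum.
  rewrite /qleval (reindex (cast_ord szp)) /=; last first.
    by exists (cast_ord (esym szp)) => i _; rewrite ?cast_ordK ?cast_ordKV.
  apply: eq_bigr => i _; rewrite mxE /psi (nth_map 0) //.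
  by rewrite size_tuple; exact: ltn_ord (cast_ord szp i).
exists psi, g; split => // [w|v].
- exists (\sum_(i < \dim W) w 0 (cast_ord (esym szp) i) *: X`_i); apply/rowP => i.
  rewrite mxE daddv_pi_id //; last first.
    by apply: memv_suml => k _; rewrite memvZ // vbasis_mem // mem_nth ?size_tuple.
  by rewrite coord_sum_free ?cast_ordK // (basis_free (vbasisP W)).
- split=> [gv0|v0].
    rewrite -evg gv0 /qleval big1 // => i _.
    by rewrite mxE expr0n mulr0.
  have vU : v \in U by rewrite UP v0.
  have piW : daddv_pi W U v = 0.
    have : daddv_pi W U v \in (W :&: U)%VS.
      by rewrite memv_cap memv_pi UP evE v0 eqxx.
    by rewrite UWc memv0 => /eqP.
  by apply/rowP => i; rewrite !mxE piW linear0.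
Qed.

End Facts.

(* Main.v *)
Require Import Defs.
From mathcomp Require Import boolp mpoly.
From mathcomp Require Import all_boot all_order all_algebra zify ring.

(* Write D(phi) for the set of values of phi; over K it is a K^2-subspace of K,
   and phi is anisotropic when its coefficients are K^2-independent.  An
   isotropic vector of q over K = F(p) lifts to homogeneous polynomials f_j with
   q(f) = h p.  Differentiating this identity with respect to the squares T_k^2
   shows that u D(p_K) is contained in D(q_K), where u is the value of h at the
   generic point; and the values u obtained in this way from a maximal totally
   isotropic subspace form a K^2-independent family of i_0(q_K) elements.  For
   q = p they lie in G = {g : g D(p_K) is contained in D(p_K)}, a field, so
   [G : K^2] >= i_1(p).  In general, the bound on i_0(q_K) leaves no room in
   D(q_K) for a further copy of G beside u D(p_K), so that the quotients of the
   elements u lie in G and [G : K^2] >= i_0(q_K).  Finally G is the value set of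
   a quasi-Pfister form, and p_1, whose value set is a G-space, is divisible by it. *)

Set Implicit Arguments.
Unset Strict Implicit.
Unset Printing Implicit Defensive.

Import Order.TTheory GRing.Theory Num.Theory.
Local Open Scope ring_scope.

(** * Homogeneous polynomials, common denominators and division by squares *)

Section MPolyFacts.
Variables (F : fieldType) (n : nat).

(** The component of [h * f] in degree [j + e] is [f] times the degree-[j] component of [h], so the
    latter vanishes unless [j + e = d]. *)
Lemma dhomog_divr d e (f h : {mpoly F[n]}) :
  f != 0 -> f \is e.-homog -> h * f \is d.-homog -> h \is (d - e).-homog.
Proof.
move=> f0 fe hfd.
have [N leN] : exists N, (msize h <= N)%N by exists (msize h).
have hE := pihomog_partitionE leN; rewrite [h]hE.
apply: rpred_sum => /= j _.
have [->|jde] := eqVneq (j : nat) (d - e)%N; first exact: pihomogP.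
suff -> : pihomog mdeg j h = 0 by exact: rpred0.
have jed : d != (j + e)%N by apply: contraNneq jde => ->; rewrite addnK.
apply/eqP; suff : pihomog mdeg j h * f == 0 by rewrite mulf_eq0 (negPf f0) orbF.
rewrite -(pihomog_ne0 jed hfd) {2}hE [X in _ == pihomog _ _ X]mulr_suml.
rewrite (linear_sum (pihomog mdeg (j + e))) /=.
rewrite (bigD1 j) //= big1 ?addr0 => [|k kj].
  by rewrite [X in _ == X]pihomog_dE //; apply: dhomogM => //; exact: pihomogP.
apply: (pihomog_ne0 (d := (k + e)%N)); last by apply: dhomogM => //; exact: pihomogP.
by rewrite eqn_add2r.
Qed.

(** Serves to pass between the homogeneous coordinates of a point and their quotients by one of
    them. *)
Lemma mmap_dhomog_scale (K : comNzRingType) (iota : {rmorphism F -> K})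
    (t : 'I_n -> K) c d (f : {mpoly F[n]}) :
  f \is d.-homog -> mmap iota (fun i => t i * c) f = mmap iota t f * c ^+ d.
Proof.
move=> /dhomogP fd; rewrite /mmap mulr_suml big_seq [RHS]big_seq.
apply: eq_bigr => m /fd <-; rewrite -mulrA; congr (_ * _).
rewrite /mmap1 [X in c ^+ X](mdegE m) -prodrXr -big_split.
by apply: eq_bigr => i _; rewrite exprMn.
Qed.

Lemma mmap_rmorph (K L : comNzRingType) (iota : {rmorphism F -> K})
    (j : {rmorphism K -> L}) (t : 'I_n -> K) (f : {mpoly F[n]}) :
  j (mmap iota t f) = mmap (j \o iota) (j \o t) f.
Proof.
rewrite /mmap rmorph_sum; apply: eq_bigr => m _; rewrite rmorphM; congr (_ * _).
by rewrite rmorph_prod; apply: eq_bigr => i _; rewrite rmorphXn.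
Qed.

Lemma mpoly_common_denominator (K : fieldType) (iota : {rmorphism F -> K})
    (t : 'I_n -> K) (I : finType) (z : I -> K) :
  (forall y : K, exists d (f g : {mpoly F[n]}),
     [/\ f \is d.-homog, g \is d.-homog, mmap iota t g != 0
       & y = mmap iota t f / mmap iota t g]) ->
  exists d (g : {mpoly F[n]}) (f : I -> {mpoly F[n]}),
    [/\ mmap iota t g != 0, forall s, f s \is d.-homog
      & forall s, z s = mmap iota t (f s) / mmap iota t g].
Proof.
move=> frac; set ev := mmap iota t.
(* The invariant adds that [g] is homogeneous of the degree of the numerators; cross-multiplication
   by a new denominator then keeps all degrees equal. *)
suff [d [g [f [g0 gd fd fE]]]] : exists d (g : {mpoly F[n]}) (f : I -> {mpoly F[n]}),
    [/\ ev g != 0, g \is d.-homog, forall s, s \in enum I -> f s \is d.-homog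
      & forall s, s \in enum I -> z s = ev (f s) / ev g].
  by exists d, g, f; split=> // s; [apply: fd | apply: fE]; rewrite mem_enum.
elim: (enum I) => [|s l [d [g [f [g0 gd fd fE]]]]].
  by exists 0%N, 1, (fun=> 0); rewrite /ev rmorph1 oner_neq0 dhomog1.
have [d' [f' [g' [f'd g'd g'0 zE]]]] := frac (z s).
exists (d + d')%N, (g * g'), (fun i => if i == s then f' * g else f i * g').
rewrite /ev rmorphM /= -/ev in g'0 zE *; split.
- by rewrite mulf_neq0.
- exact: dhomogM.
- move=> i; rewrite inE; case: eqVneq => [_ _|_ /= /fd id]; last exact: dhomogM.
  by rewrite addnC; exact: dhomogM.
- move=> i; rewrite inE; case: eqVneq => [-> _|_ /= /fE ->].
    by rewrite /ev rmorphM zE -/ev mulrC [_ * ev g]mulrC -mulf_div divff ?mulr1 ?mul1r // mulrC.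
  by rewrite /ev rmorphM -/ev -mulf_div (divff g'0) mulr1.
Qed.

Hypothesis char2 : 2%N \in [pchar F].

Let mchar2 : 2%N \in [pchar {mpoly F[n]}].
Proof. exact: (rmorph_pchar (@mpolyC n F)). Qed.

(* Division of all [f j] by [g] at once: the highest monomial [mu] occurring
   in the [f j] survives in the sum as its square, because the coefficients
   there form a nonzero vector of the anisotropic form; hence the leading
   monomial of [g] divides [mu], and subtracting multiples of [g] removes [mu]. *)
Lemma anisotropic_sqr_dvd m (b : 'I_m -> F) (f : 'I_m -> {mpoly F[n]})
    (g h : {mpoly F[n]}) :
  (forall c : 'I_m -> F, \sum_j b j * c j ^+ 2 = 0 -> forall j, c j = 0) ->
  g != 0 -> \sum_j b j *: f j ^+ 2 = h * g ^+ 2 ->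
  forall j, exists k, f j = k * g.
Proof.
move=> aniso g0.
(* The leading monomial of 0 is the least one, so a maximum over the nonzero entries dominates all
   of them. *)
have max_lead (v : 'I_m -> {mpoly F[n]}) j : v j != 0 -> exists2 i, v i != 0 &
    forall k, (mlead (v k) <= mlead (v i))%O.
  move=> vj0; case: (@Order.TotalTheory.arg_maxP _ _ _ j (fun i => v i != 0)
    (fun i => mlead (v i)) vj0) => i vi0 imax; exists i => // k.
  have [->|/imax //] := eqVneq (v k) 0; rewrite mlead0; exact: le0x.
suff main mu : forall (f : 'I_m -> {mpoly F[n]}) h i,
    f i != 0 -> mlead (f i) = mu -> (forall k, (mlead (f k) <= mu)%O) ->
    \sum_j b j *: f j ^+ 2 = h * g ^+ 2 -> forall j, exists k, f j = k * g.
  move=> fE; have [f0|] := pselect (forall j, f j = 0).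
    by move=> j; exists 0; rewrite f0 mul0r.
  move=> /existsNP[j /eqP /(max_lead f)[i fi0 imax]].
  exact: (main _ f h i).
elim/(ltmwf (n := n)): mu => mu IH {}f {}h i fi0 fimu fmu fE.
have sq_coef (v : {mpoly F[n]}) : (mlead v <= mu)%O -> (v ^+ 2)@_(mu + mu) = v@_mu ^+ 2.
  by move=> vmu; rewrite expr2 mleadcMW.
have sum_coef : (\sum_j b j *: f j ^+ 2)@_(mu + mu) = \sum_j b j * (f j)@_mu ^+ 2.
  by rewrite raddf_sum; apply: eq_bigr => j _; rewrite /= mcoeffZ sq_coef.
have sum_coef0 : (h * g ^+ 2)@_(mu + mu) != 0.
  rewrite -fE sum_coef; apply/negP => /eqP /aniso /(_ i) /eqP.
  by rewrite -fimu mleadc_eq0 (negPf fi0).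
have h0 : h != 0 by apply: contraNneq sum_coef0 => ->; rewrite mul0r mcoeff0.
(* The monomial [mu + mu] occurs in the sum and bounds all its monomials, so it is the leading one;
   halving exponents then gives that [mlead g] divides [mu]. *)
have leadE : (mlead h + (mlead g + mlead g) = mu + mu)%MM.
  rewrite -mleadM // -mleadM ?mulf_neq0 // -expr2; apply/le_anti/andP; split; last first.
    by apply: msupp_le_mlead; rewrite mcoeff_msupp.
  rewrite -fE; apply: (le_trans (mlead_sum_le _ _ _)).
  apply/joinsP => j _; apply: (le_trans (mleadZ_le _ _)); rewrite expr2.
  apply: (le_trans (mleadM_le _ _)); apply: (@le_trans _ _ (mlead (f j) + mu)%MM).
    by rewrite lemc_add2r.
  by rewrite lemc_add2l.
have gmu : (mlead g <= mu)%MM.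
  apply/mnm_lepP => k; have /mnmP/(_ k) := leadE; rewrite !mnmDE => E; lia.
pose v j : {mpoly F[n]} := ((f j)@_mu / mleadc g) *: 'X_[mu - mlead g].
pose f' j := f j - v j * g.
have f'le j : (mlead (f' j) <= mu)%O.
  apply: (le_trans (mleadB_le _ _)); rewrite leUx fmu /= /v -scalerAl.
  apply: (le_trans (mleadZ_le _ _)); apply: (le_trans (mleadM_le _ _)).
  by rewrite mleadXm submK.
have f'mu j : (f' j)@_mu = 0.
  have XgE : ('X_[mu - mlead g] * g)@_mu = mleadc g.
    by rewrite -[X in _@_X](submK gmu) mulrC mcoeffMX.
  rewrite mcoeffB /v -scalerAl mcoeffZ XgE.
  by rewrite divfK ?subrr // mleadc_eq0.
(* Squaring is additive, so the reduced family satisfies an identity of the same kind with a new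
   cofactor, and the induction applies to it. *)
have f'E : \sum_j b j *: f' j ^+ 2 = (h + \sum_j b j *: v j ^+ 2) * g ^+ 2.
  rewrite mulrDl -fE mulr_suml -big_split; apply: eq_bigr => j _ /=.
  rewrite -scalerAl -exprMn -scalerDr; congr (_ *: _).
  by rewrite /f' (oppr_pchar2 mchar2) -!(pFrobenius_autE mchar2) rmorphD.
have fj j : (exists k, f' j = k * g) -> exists k, f j = k * g.
  by move=> [k kE]; exists (k + v j); rewrite mulrDl -kE subrK.
move=> j; apply: fj; move: j.
have [f'0 j|/existsNP[j0 /eqP /(max_lead f')[i' f'i0 imax]]] := pselect (forall j, f' j = 0).
  by exists 0; rewrite f'0 mul0r.
apply: (IH _ _ f' (h + \sum_j b j *: v j ^+ 2) i') => //.
rewrite lt_neqAle f'le andbT; apply: contraNneq f'i0 => E.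
by rewrite -mleadc_eq0 E f'mu.
Qed.

End MPolyFacts.

(** * Value sets of forms, and anisotropy as independence over the squares *)

Definition qlvalue (F : fieldType) (phi : qlform F) (x : F) : Prop :=
  exists v : 'rV[F]_(qldim phi), qleval v = x.

Section ValueSets.
Variable F : fieldType.
Hypothesis char2 : 2%N \in [pchar F].
Implicit Types (phi psi : qlform F) (x y a c : F).

Let addrr x : x + x = 0. Proof. exact: addrr_pchar2. Qed.

Lemma qleval0 phi : qleval (0 : 'rV[F]_(qldim phi)) = 0.
Proof. by rewrite /qleval big1 // => i _; rewrite mxE expr0n mulr0. Qed.

Lemma qleval_sum phi (I : finType) (w : I -> 'rV[F]_(qldim phi)) :
  qleval (\sum_i w i) = \sum_i qleval (w i).
Proof. exact: (big_morph (@qleval F phi) (fun u v => qlevalD char2 u v) (qleval0 phi)). Qed.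

Lemma qleval_mulmx phi m (v : 'rV[F]_m) (M : 'M[F]_(m, qldim phi)) :
  qleval (v *m M) = \sum_i qleval (row i M) * v 0 i ^+ 2.
Proof.
rewrite mulmx_sum_row qleval_sum; apply: eq_bigr => i _.
by rewrite qlevalZ mulrC.
Qed.

Lemma qleval_inj phi : anisotropic phi -> injective (@qleval F phi).
Proof.
move=> aniso v w vw; apply/eqP; rewrite -subr_eq0; apply/negP => /negP vw0.
apply: aniso; exists (v - w) => //; rewrite -scaleN1r (qlevalD char2) (qlevalZ).
by rewrite vw sqrrN expr1n mul1r addrr.
Qed.

(** Anisotropy as independence of the coefficients over the squares. The length [m] is a separate
    variable, for forms such as a base change whose size is known only up to a provable equality. *)
Lemma anisotropicP phi m : size phi = m -> anisotropic phi <->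
  forall c : 'I_m -> F, \sum_(j < m) nth 0 phi j * c j ^+ 2 = 0 -> forall j, c j = 0.
Proof.
move=> <-; split=> [aniso c c0 j|aniso [v v0 /aniso vE]]; last first.
  by case/eqP: v0; apply/rowP => j; rewrite mxE vE.
have E : qleval (\row_i c i : 'rV_(qldim phi)) = 0.
  by rewrite -[RHS]c0; apply: eq_bigr => i _; rewrite mxE.
have /rowP/(_ j) := qleval_inj aniso (etrans E (esym (qleval0 _))).
by rewrite !mxE.
Qed.

Lemma qlvalue_nil x : qlvalue [::] x <-> x = 0.
Proof.
split=> [[v <-]|->]; first by rewrite /qleval big_ord0.
by exists 0; rewrite qleval0.
Qed.

Definition qlrow_cons a c phi (v : 'rV[F]_(qldim phi)) : 'rV[F]_(qldim (a :: phi)) :=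
  \row_i oapp (v 0) c (unlift ord0 i).

Lemma qleval_row_cons a c phi (v : 'rV[F]_(qldim phi)) :
  qleval (qlrow_cons a c v) = a * c ^+ 2 + qleval v.
Proof.
rewrite {1}/qleval big_ord_recl mxE unlift_none; congr (_ + _).
by apply: eq_bigr => i _; rewrite mxE liftK.
Qed.

Lemma qlvalue_cons a phi x :
  qlvalue (a :: phi) x <-> exists c y, qlvalue phi y /\ x = a * c ^+ 2 + y.
Proof.
split=> [[v <-]|[c [_ [[v <-] ->]]]].
  exists (v 0 ord0), (qleval (\row_i v 0 (lift ord0 i) : 'rV_(qldim phi))).
  split; first by eexists.
  rewrite {1}/qleval big_ord_recl; congr (_ + _).
  by apply: eq_bigr => i _; rewrite mxE.
by exists (qlrow_cons a c v); exact: qleval_row_cons.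
Qed.

Lemma anisotropic_nil : anisotropic ([::] : qlform F).
Proof. by apply/(anisotropicP erefl) => c _ []. Qed.

Lemma qlvalue0 phi : qlvalue phi 0.
Proof. by exists 0; exact: qleval0. Qed.

Lemma qlvalueD phi x y : qlvalue phi x -> qlvalue phi y -> qlvalue phi (x + y).
Proof. by move=> [v <-] [w <-]; exists (v + w); exact: qlevalD. Qed.

Lemma qlvalueZ phi c x : qlvalue phi x -> qlvalue phi (c ^+ 2 * x).
Proof. by move=> [v <-]; exists (c *: v); exact: qlevalZ. Qed.

Lemma mem_qlvalue phi a : a \in phi -> qlvalue phi a.
Proof.
elim: phi => // b phi IH; rewrite inE => /predU1P[->|/IH phia]; apply/qlvalue_cons.
  by exists 1, 0; split; [exact: qlvalue0 | rewrite expr1n mulr1 addr0].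
by exists 0, a; rewrite expr0n mulr0 add0r.
Qed.

Definition sq_subspace (S : F -> Prop) : Prop :=
  [/\ S 0, forall x y, S x -> S y -> S (x + y) & forall c x, S x -> S (c ^+ 2 * x)].

Lemma qlvalue_subspace phi : sq_subspace (qlvalue phi).
Proof. by split; [exact: qlvalue0 | exact: qlvalueD | exact: qlvalueZ]. Qed.

(** The value set is the span of the coefficients over the squares, so inclusions between value sets
    can be tested on coefficients. *)
Lemma qlvalue_min phi (S : F -> Prop) : sq_subspace S ->
  (forall a, a \in phi -> S a) -> forall x, qlvalue phi x -> S x.
Proof.
move=> [S0 SD SZ]; elim: phi => [|a phi IH] phiS x; first by move=> /qlvalue_nil ->.
move=> /qlvalue_cons[c [y [phiy ->]]]; apply: SD.
  by rewrite mulrC; apply/SZ/phiS; rewrite mem_head.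
by apply: IH => // b bphi; apply: phiS; rewrite inE bphi orbT.
Qed.

(** In a vanishing relation, a nonzero square in front of [a] can be divided out, which makes [a] a
    value of [phi]. *)
Lemma anisotropic_cons a phi :
  anisotropic phi -> ~ qlvalue phi a -> anisotropic (a :: phi).
Proof.
move=> aniso nphia [v v0 vE]; apply: nphia.
pose w : 'rV_(qldim phi) := \row_i v 0 (lift ord0 i).
have E : a * v 0 ord0 ^+ 2 + qleval w = 0.
  rewrite -[RHS]vE {2}/qleval big_ord_recl; congr (_ + _).
  by apply: eq_bigr => i _; rewrite mxE.
have [va0|va0] := eqVneq (v 0 ord0) 0.
  exfalso; apply: aniso; exists w; last by rewrite -[RHS]E va0 expr0n mulr0 add0r.
  apply: contraNneq v0 => w0; apply/eqP/rowP => i; rewrite mxE.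
  by case: (unliftP ord0 i) => [k ->|-> //]; have /rowP/(_ k) := w0; rewrite !mxE.
have -> : a = (v 0 ord0)^-1 ^+ 2 * qleval w.
  have -> : qleval w = a * v 0 ord0 ^+ 2.
    by apply/eqP; rewrite -subr_eq0 (oppr_pchar2 char2) addrC E.
  by rewrite mulrCA -exprMn mulVf // expr1n mulr1.
by apply: qlvalueZ; eexists.
Qed.

Lemma qlvalue_cat phi psi x : qlvalue (phi ++ psi) x <->
  exists y z, [/\ qlvalue phi y, qlvalue psi z & x = y + z].
Proof.
split.
  apply: (qlvalue_min (S := fun x => exists y z,
    [/\ qlvalue phi y, qlvalue psi z & x = y + z])) => [|a].
    split; first by exists 0, 0; rewrite addr0; split=> //; exact: qlvalue0.
      move=> _ _ [y [z [vy vz ->]]] [y' [z' [vy' vz' ->]]].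
      by exists (y + y'), (z + z'); rewrite addrACA; split=> //; exact: qlvalueD.
    move=> c _ [y [z [vy vz ->]]]; exists (c ^+ 2 * y), (c ^+ 2 * z).
    by rewrite mulrDr; split=> //; exact: qlvalueZ.
  rewrite mem_cat => /orP[] /mem_qlvalue va; [exists a, 0 | exists 0, a];
    by rewrite ?addr0 ?add0r; split=> //; exact: qlvalue0.
have sub s : (forall a, a \in s -> a \in phi ++ psi) ->
    forall y, qlvalue s y -> qlvalue (phi ++ psi) y.
  move=> ss; apply: qlvalue_min; first exact: qlvalue_subspace.
  by move=> a /ss; exact: mem_qlvalue.
move=> [y [z [vy vz ->]]]; apply: qlvalueD; [apply: sub vy | apply: sub vz] => a;
  by rewrite mem_cat => ->; rewrite ?orbT.
Qed.

Lemma anisotropic_consP a phi :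
  anisotropic (a :: phi) <-> anisotropic phi /\ ~ qlvalue phi a.
Proof.
split=> [aniso|[]]; last exact: anisotropic_cons.
split=> [[v v0 vE]|[v vE]]; apply: aniso.
  exists (qlrow_cons a 0 v); last by rewrite qleval_row_cons vE expr0n mulr0 addr0.
  apply: contraNneq v0 => w0; apply/eqP/rowP => i.
  by have /rowP/(_ (lift ord0 i)) := w0; rewrite !mxE liftK.
exists (qlrow_cons a 1 v); last by rewrite qleval_row_cons vE expr1n mulr1 addrr.
apply/eqP => /rowP/(_ ord0); rewrite !mxE unlift_none.
by apply/eqP; rewrite oner_neq0.
Qed.

Lemma anisotropic_cat phi psi : anisotropic phi -> anisotropic psi ->
  (forall x, qlvalue phi x -> qlvalue psi x -> x = 0) -> anisotropic (phi ++ psi).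
Proof.
move=> phi_an psi_an; elim: phi phi_an => // a phi IH /anisotropic_consP[phi_an nphia] disj.
have sub x : qlvalue phi x -> qlvalue (a :: phi) x.
  by move=> vx; apply/qlvalue_cons; exists 0, x; rewrite expr0n mulr0 add0r.
apply/anisotropic_consP; split.
  by apply: IH => // x /sub; exact: disj.
move=> /qlvalue_cat[y [z [vy vz aE]]]; apply: nphia.
suff z0 : z = 0 by rewrite aE z0 addr0.
apply: disj => //; have -> : z = a + y by rewrite aE addrAC addrr add0r.
by apply: qlvalueD; [apply: mem_qlvalue; rewrite mem_head | exact: sub].
Qed.

Lemma qlvalue_scale a phi x :
  qlvalue (map ( *%R a) phi) x <-> exists2 y, qlvalue phi y & x = a * y.
Proof.
split; last first.
  move=> [y vy ->]; move: y vy; apply: (qlvalue_min (S := fun y => qlvalue _ (a * y))).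
    split; first by rewrite mulr0; exact: qlvalue0.
      by move=> y z vy vz; rewrite mulrDr; exact: qlvalueD.
    by move=> c y vy; rewrite mulrCA; exact: qlvalueZ.
  by move=> b bphi; apply: mem_qlvalue; exact: map_f.
apply: (qlvalue_min (S := fun x => exists2 y, qlvalue phi y & x = a * y));
  last by move=> _ /mapP[b /mem_qlvalue bphi ->]; exists b.
split; first by exists 0; [exact: qlvalue0 | rewrite mulr0].
  by move=> _ _ [y vy ->] [z vz ->]; exists (y + z); [exact: qlvalueD | rewrite mulrDr].
by move=> c _ [y vy ->]; exists (c ^+ 2 * y); [exact: qlvalueZ | rewrite mulrCA].
Qed.

Lemma anisotropic_scale a phi :
  a != 0 -> anisotropic phi -> anisotropic (map ( *%R a) phi).
Proof.
move=> a0 /(anisotropicP erefl) phi_an; apply/(anisotropicP (size_map _ _)) => c cE.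
apply: phi_an; apply: (mulfI a0); rewrite mulr0 -[RHS]cE mulr_sumr.
by apply: eq_bigr => i _; rewrite (nth_map 0) // mulrA.
Qed.

Lemma qlvalue_sub_mx phi psi : (forall a, a \in phi -> qlvalue psi a) ->
  exists M : 'M[F]_(qldim phi, qldim psi), forall v, qleval (v *m M) = qleval v.
Proof.
move=> sub; have : forall i : 'I_(qldim phi),
    exists w : 'rV[F]_(qldim psi), qleval w = nth 0 phi i.
  by move=> i; apply: sub; exact: mem_nth.
move=> /choice[w wE].
exists (\matrix_i w i) => v; rewrite qleval_mulmx.
by apply: eq_bigr => i _; rewrite rowK wE.
Qed.

(** A matrix expresses the values of [phi] through [psi]; with more rows than columns it would kill
    a nonzero vector, which would be isotropic for [phi]. *)
Lemma anisotropic_leq_size phi psi : anisotropic phi ->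
  (forall a, a \in phi -> qlvalue psi a) -> (size phi <= size psi)%N.
Proof.
move=> phi_an /qlvalue_sub_mx[M ME]; rewrite leqNgt; apply/negP => lt.
have : kermx M != 0.
  rewrite kermx_eq0 /row_free neq_ltn (leq_ltn_trans (rank_leq_col M)) //.
case/rowV0Pn => v /sub_kermxP vM v0; apply: phi_an; exists v => //.
by rewrite -ME vM qleval0.
Qed.

(** The value-preserving matrices in both directions are mutually inverse, because [qleval] is
    injective on an anisotropic form. *)
Lemma anisotropic_isometric phi psi : anisotropic phi -> anisotropic psi ->
  (forall x, qlvalue phi x <-> qlvalue psi x) -> isometric phi psi.
Proof.
move=> phi_an psi_an eqv.
have [M ME] : exists M : 'M[F]_(qldim phi, qldim psi), forall v, qleval (v *m M) = qleval v.
  by apply: qlvalue_sub_mx => a /mem_qlvalue/eqv.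
have [N NE] : exists N : 'M[F]_(qldim psi, qldim phi), forall v, qleval (v *m N) = qleval v.
  by apply: qlvalue_sub_mx => a /mem_qlvalue/eqv.
exists (mulmxr M); split=> //.
exists (mulmxr N) => v /=.
  by apply: (qleval_inj phi_an); rewrite NE ME.
by apply: (qleval_inj psi_an); rewrite ME NE.
Qed.

(** The isotropic vectors together with 0 form a subspace, which contains every totally isotropic
    one. *)
Lemma iso_indexE phi (U : {vspace 'rV[F]_(qldim phi)}) :
  (forall v, (v \in U) = (qleval v == 0)) -> iso_index phi = \dim U.
Proof.
move=> UE; apply/eqP; rewrite eqn_leq; apply/andP; split.
  apply/bigmax_leqP => k /asboolP[W Wiso <-]; apply: dimvS.
  by apply/subvP => v /Wiso vE; rewrite UE vE.
have dimU : (\dim U < (qldim phi).+1)%N.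
  by rewrite ltnS (leq_trans (dimvS (subvf U))) // dimvf /dim /= mul1n.
apply: (@leq_bigmax_cond _ _ _ (Ordinal dimU)); apply/asboolP; exists U => //.
by move=> v; rewrite UE => /eqP.
Qed.

Lemma qlvalue_anisotropic_part phi x :
  qlvalue (anisotropic_part phi) x <-> qlvalue phi x.
Proof.
have [f [f_surj _ fE]] := anisotropic_partP char2 phi.
split=> [[w <-]|[v <-]]; last by exists (f v).
by have [v <-] := f_surj w; exists v.
Qed.

Lemma anisotropic_part_anisotropic phi : anisotropic (anisotropic_part phi).
Proof.
have [f [f_surj f_ker fE]] := anisotropic_partP char2 phi.
move=> [w w0 wE]; have [v vw] := f_surj w; case/eqP: w0.
by rewrite -vw; apply/f_ker; rewrite -fE vw.
Qed.

Lemma size_anisotropic_part phi :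
  (size (anisotropic_part phi) + iso_index phi)%N = size phi.
Proof.
have [U UE] := isotropic_vspace char2 phi; rewrite (iso_indexE UE).
have [f [f_surj f_ker _]] := anisotropic_partP char2 phi.
have linE : linfun f =1 f by exact: lfunE.
have kerE : lker (linfun f) = U.
  apply/vspaceP => v; rewrite UE memv_ker linE; apply/eqP/eqP=> /f_ker //.
have imE : limg (linfun f) = fullv.
  apply/vspaceP => w; rewrite memvf; have [u <-] := f_surj w.
  by rewrite -linE memv_img // memvf.
have := limg_ker_dim (linfun f) fullv.
rewrite capfv kerE imE addnC.
by rewrite [\dim {: _}]dimvf [X in _ = X -> _]dimvf /dim /= !mul1n.
Qed.

End ValueSets.

(** * The generic point of the quadric *)

(* [t] are affine coordinates of the generic point of the quadric [p = 0]. *)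
Definition generic_point (F : fieldType) (p : qlform F) (K : fieldType)
    (iota : {rmorphism F -> K}) (t : 'I_(qldim p) -> K) : Prop :=
  (forall d (f : {mpoly F[qldim p]}), f \is d.-homog ->
     mmap iota t f = 0 <-> exists g, f = g * qlpoly p) /\
  (forall z : K, exists d (f g : {mpoly F[qldim p]}),
     [/\ f \is d.-homog, g \is d.-homog, mmap iota t g != 0
       & z = mmap iota t f / mmap iota t g]).

Lemma dhomog_qlpoly (F : fieldType) (p : qlform F) : qlpoly p \is 2.-homog.
Proof.
apply: rpred_sum => i _; apply: rpredZ.
by rewrite mpolyXn dhomogX /= mdegMn mdeg1.
Qed.

Lemma mmap_qlpoly (F : fieldType) (p : qlform F) (K : comNzRingType)
    (iota : {rmorphism F -> K}) (t : 'I_(qldim p) -> K) :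
  mmap iota t (qlpoly p) = \sum_(l < qldim p) iota (nth 0 p l) * t l ^+ 2.
Proof.
rewrite /qlpoly raddf_sum; apply: eq_bigr => l _ /=.
by rewrite mmapZ rmorphXn /= mmapX mmap1U.
Qed.

Lemma qlpoly_neq0 (F : fieldType) (p : qlform F) :
  2%N \in [pchar F] -> anisotropic p -> (0 < qldim p)%N -> qlpoly p != 0.
Proof.
move=> char2 /(anisotropicP char2 erefl) p_an p_gt0; apply/negP => /eqP P0.
have := p_an (fun=> 1) _ (Ordinal p_gt0); rewrite -(mmap_qlpoly idfun) P0 mmap0.
by move=> /(_ erefl)/eqP; rewrite oner_eq0.
Qed.

(** The coordinates are [t i = x i / x i0]. On forms of degree [d], evaluation at [x] and at [t]
    differ by the factor [x i0 ^+ d], which cancels in fractions. *)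
Lemma function_field_generic_point (F : fieldType) (p : qlform F)
    (K : fieldType) (iota : {rmorphism F -> K}) :
  (0 < qldim p)%N -> is_function_field p iota ->
  exists t : 'I_(qldim p) -> K, generic_point iota t.
Proof.
move=> p_gt0 [L [j [x [ker frac]]]]; pose i0 := Ordinal p_gt0.
pose ev := mmap (j \o iota) x.
have evX i : ev 'X_i = x i by rewrite /ev mmapX mmap1U.
(* Otherwise the linear polynomial ['X_i0] would be a multiple of the quadratic polynomial
   [qlpoly p]. *)
have x0 : x i0 != 0.
  apply/eqP => x0; have [g gE] := (ker 'X_i0).1 (etrans (evX i0) x0).
  have gP0 : g * qlpoly p != 0 by rewrite -gE -msize_poly_eq0 msizeX.
  have [g0 P0] : g != 0 /\ qlpoly p != 0 by move: gP0; rewrite mulf_eq0 negb_or => /andP.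
  have := congr1 (fun u => msize u) gE.
  have := dhomog_uniq P0 (dhomog_qlpoly p) (dhomog_msize (dhomog_qlpoly p)).
  rewrite msizeX mdeg1 msizeM // => PE.
  have : (0 < msize g)%N by rewrite lt0n msize_poly_eq0.
  move: PE; move: (mmeasure _ (qlpoly p)) (mmeasure _ g) => a b; lia.
have Xhom i : ('X_i : {mpoly F[qldim p]}) \is 1.-homog by rewrite dhomogX /= mdeg1.
have [t tE] : exists t : 'I_(qldim p) -> K, forall i, j (t i) = x i / x i0.
  suff /choice[t tE] : forall i, exists y, j y = x i / x i0 by exists t.
  move=> i; apply/frac; exists 1%N, 'X_i, 'X_i0.
  by split=> //; rewrite -?/(ev _) ?evX.
have evE d f : f \is d.-homog -> ev f = j (mmap iota t f) * x i0 ^+ d.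
  move=> fd; rewrite mmap_rmorph -(mmap_dhomog_scale _ _ _ fd); congr (mmap _ _ f).
  by apply/funext => i /=; rewrite tE divfK.
exists t; split=> [d f fd|z].
  rewrite -ker -/(ev f) (evE _ _ fd); split=> [->|/eqP]; first by rewrite rmorph0 mul0r.
  by rewrite mulf_eq0 expf_eq0 (negPf x0) andbF orbF fmorph_eq0 => /eqP.
have [d [f [g [fd gd]]]] := (frac (j z)).1 (ex_intro _ z erefl).
rewrite -/(ev f) -/(ev g) (evE _ _ fd) (evE _ _ gd).
rewrite mulf_eq0 negb_or fmorph_eq0 => /andP[g0 xd0] zE.
exists d, f, g; split=> //; apply: (fmorph_inj j).
by rewrite zE -mulf_div divff // mulr1 fmorph_div.
Qed.

(** * Elements u with u D(p_K) inside D(q_K), obtained from isotropic vectors *)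

Section Multipliers.
Variables (F : fieldType) (p q : qlform F) (K : fieldType) (iota : {rmorphism F -> K}).
Variable t : 'I_(qldim p) -> K.
Hypotheses (char2 : 2%N \in [pchar F]) (tP : generic_point iota t).

Let Kchar2 : 2%N \in [pchar K]. Proof. exact: rmorph_pchar iota _ char2. Qed.

Let ev : {mpoly F[qldim p]} -> K := mmap iota t.

Let evP d f : f \is d.-homog -> ev f = 0 <-> exists g, f = g * qlpoly p.
Proof. exact: tP.1. Qed.

Let ev_qlpoly : ev (qlpoly p) = 0.
Proof. by apply/(evP (dhomog_qlpoly p)); exists 1; rewrite mul1r. Qed.

(** Restriction to the line through [t] in the direction of the [k]-th axis; the coefficient of ['X]
    is the [k]-th partial derivative at [t]. *)
Let taylor (k : 'I_(qldim p)) : {mpoly F[qldim p]} -> {poly K} :=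
  mmap (polyC \o iota) (fun l => (t l)%:P + (l == k)%:R *: 'X).

Let taylor_coef0 k f : (taylor k f)`_0 = ev f.
Proof.
rewrite -horner_coef0 -[_.[0]]/(horner_eval 0 _) mmap_rmorph.
congr (mmap _ _ f); apply/funext => l /=; rewrite /horner_eval !hornerE //.
Qed.

Let taylor_qlpoly k : taylor k (qlpoly p) = (iota (nth 0 p k))%:P * 'X^2.
Proof.
have Xchar2 : 2%N \in [pchar {poly K}] by exact: rmorph_pchar (@polyC K) _ Kchar2.
have E : taylor k (qlpoly p) = (ev (qlpoly p))%:P + (iota (nth 0 p k))%:P * 'X^2.
  have -> : ev (qlpoly p) = \sum_(l < qldim p) iota (nth 0 p l) * t l ^+ 2
    by exact: mmap_qlpoly.
  rewrite /taylor {1}/qlpoly raddf_sum raddf_sum /=.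
  rewrite [in RHS](bigD1 k) // [LHS](bigD1 k) //= addrAC; congr (_ + _).
    rewrite mmapZ rmorphXn /= mmapX mmap1U eqxx scale1r polyCM -mulrDr; congr (_ * _).
    by rewrite -(pFrobenius_autE Xchar2) rmorphD /= !pFrobenius_autE polyC_exp.
  apply: eq_bigr => l /negPf lk; rewrite mmapZ rmorphXn /= mmapX mmap1U lk.
  by rewrite scale0r addr0 polyCM polyC_exp.
by rewrite E ev_qlpoly add0r.
Qed.

(** The mixed product of the coefficients of degrees 0 and 2 occurs twice and cancels. *)
Let coef2_sqr (f : {poly K}) : (f ^+ 2)`_2 = f`_1 ^+ 2.
Proof.
rewrite expr2 coefM !big_ord_recl big_ord0 /= addr0 /bump /=.
by rewrite !subnn !subSS !subn0 [f`_2 * _]mulrC addrCA (addrr_pchar2 Kchar2) addr0 expr2.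
Qed.

(* Comparing the coefficients of [X^2] after the substitution
   [T_k -> t_k + X]: the square [f_j^2] contributes the square of a
   derivative, and [p] contributes [a_k X^2] since it vanishes at [t]. *)
Lemma isotropic_multiplier m (b : 'I_m -> F) (f : 'I_m -> {mpoly F[qldim p]}) h k :
  \sum_j b j *: f j ^+ 2 = h * qlpoly p ->
  exists c : 'I_m -> K, ev h * iota (nth 0 p k) = \sum_j iota (b j) * c j ^+ 2.
Proof.
(* Past the dimension of [p] the coefficient is the default 0, and [c = 0] works. *)
have [kp|pk] := ltnP k (qldim p); last first.
  exists (fun=> 0); rewrite nth_default // rmorph0 mulr0 big1 // => j _.
  by rewrite expr0n mulr0.
pose k' := Ordinal kp.
move=> /(congr1 (fun g => (taylor k' g)`_2)) E; exists (fun j => (taylor k' (f j))`_1).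
have TM u v : taylor k' (u * v) = taylor k' u * taylor k' v by exact: rmorphM.
have TX u : taylor k' (u ^+ 2) = taylor k' u ^+ 2 by exact: rmorphXn.
rewrite -(taylor_coef0 k') mulrC.
transitivity (taylor k' (h * qlpoly p))`_2.
  by rewrite TM taylor_qlpoly mulrCA coefCM coefMXn.
rewrite -E /taylor rmorph_sum /= coef_sum; apply: eq_bigr => j _.
by rewrite mmapZ /= -/(taylor k' _) TX coefCM coef2_sqr.
Qed.

(* Each isotropic vector of [q] over [K] lifts to homogeneous polynomials [f_j]
   with [q(f) = h p], and [h] is the value at the vector of a form over [K];
   this form is anisotropic because [p | h] would give [p^2 | q(f)]. *)
Lemma isotropic_multipliers : anisotropic q -> qlpoly p != 0 ->
  exists us : seq K, [/\ size us = iso_index (base_change iota q), anisotropic us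
    & forall u a, u \in us -> a \in p -> qlvalue (base_change iota q) (u * iota a)].
Proof.
move=> q_an P0; set Q := base_change iota q.
have sizeq : size q = qldim Q by rewrite /qldim size_map.
have nthQ (j : 'I_(qldim Q)) : nth 0 Q j = iota (nth 0 q j).
  by rewrite (nth_map 0) // sizeq.
have [U UE] := isotropic_vspace Kchar2 Q; rewrite (iso_indexE UE).
set i := \dim U; pose e (r : 'I_i) := (vbasis U)`_r.
have eQ r : qleval (e r) = 0 by apply/eqP; rewrite -UE vbasis_mem // mem_nth ?size_tuple.
(* One denominator [g] serves all coordinates of all the basis vectors [e r], so that the lifts can
   be combined linearly. *)
have [d [g [f [g0 fd fE]]]] :=
  mpoly_common_denominator (fun s : 'I_i * 'I_(qldim Q) => e s.1 0 s.2) tP.2.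
rewrite -/ev in g0 fE.
pose qf (v : 'I_(qldim Q) -> {mpoly F[qldim p]}) := \sum_(j < qldim Q) nth 0 q j *: v j ^+ 2.
have qf_hom v c : (forall j, v j \is c.-homog) -> qf v \is (c * 2).-homog.
  by move=> vc; apply: rpred_sum => j _; apply: rpredZ; exact: dhomogMn.
have : forall r, exists h, qf (fun j => f (r, j)) = h * qlpoly p.
  move=> r; apply/(evP (qf_hom _ _ (fun j => fd (r, j)))).
  have -> : ev (qf (fun j => f (r, j))) = qleval (e r) * ev g ^+ 2.
    rewrite /ev /qf rmorph_sum mulr_suml; apply: eq_bigr => j _ /=.
    by rewrite mmapZ rmorphXn /= -/ev (fE (r, j)) nthQ -mulrA -exprMn divfK.
  by rewrite eQ mul0r.
move=> /choice[h hE].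
exists [seq ev (h r) | r : 'I_i].
have size_us : size [seq ev (h r) | r : 'I_i] = i by rewrite size_map -cardE card_ord.
have nth_us (r : 'I_i) : nth 0 [seq ev (h r) | r : 'I_i] r = ev (h r).
  by rewrite (nth_map r) ?nth_ord_enum // -cardE card_ord.
split=> //; last first.
  move=> u a /mapP[r _ ->] /(nthP 0)[k _ <-].
  have [c ->] := isotropic_multiplier k (hE r).
  exists (\row_j c j); apply: eq_bigr => j _; by rewrite mxE nthQ.
apply/(anisotropicP Kchar2 size_us) => c cE.
have [d' [g' [ga [g'0 gad gaE]]]] := mpoly_common_denominator c tP.2.
rewrite -/ev in g'0 gaE.
(* The combination of the [e r] with coefficients [c r] is lifted to the polynomials [v j], after
   clearing denominators; its value under [q] is [H * qlpoly p]. *)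
pose v j := \sum_r ga r * f (r, j).
have vhom j : v j \is (d' + d).-homog by apply: rpred_sum => r _; exact: dhomogM.
pose H := \sum_r ga r ^+ 2 * h r.
have mchar2 : 2%N \in [pchar {mpoly F[qldim p]}].
  exact: (rmorph_pchar (@mpolyC _ F)) char2.
have vE : qf v = H * qlpoly p.
  rewrite /H mulr_suml; under [RHS]eq_bigr do rewrite -mulrA -hE mulr_sumr.
  rewrite exchange_big; apply: eq_bigr => j _ /=.
  under eq_bigr do rewrite -scalerAr -exprMn.
  rewrite -scaler_sumr; congr (_ *: _).
  rewrite -!(pFrobenius_autE mchar2) rmorph_sum.
  by under [RHS]eq_bigr do rewrite -(pFrobenius_autE mchar2).
have evH : ev H = 0.
  transitivity (ev g' ^+ 2 * \sum_(j < i) nth 0 [seq ev (h r) | r : 'I_i] j * c j ^+ 2);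
    last by rewrite cE mulr0.
  rewrite /ev rmorph_sum mulr_sumr; apply: eq_bigr => r _.
  rewrite rmorphM rmorphXn /= -/ev nth_us gaE mulrCA -exprMn [_ * (_ / _)]mulrC divfK //.
  by rewrite mulrC.
(* Vanishing at [t] means divisibility by [qlpoly p] only for homogeneous polynomials; [H] is one,
   as a quotient of homogeneous polynomials. *)
have Hhom := dhomog_divr P0 (dhomog_qlpoly p).
have [h' HE] : exists h', H = h' * qlpoly p.
  by apply/(evP (Hhom _ _ _)) => //; rewrite -vE; exact: qf_hom.
have v_dvd : forall j, exists k, v j = k * qlpoly p.
  apply: (anisotropic_sqr_dvd char2 _ P0 (h := h')).
    by apply/(anisotropicP char2 sizeq).
  by rewrite expr2 mulrA -HE.
(* Up to the factor [g' * g], the [j]-th coordinate is the value of [v j] at [t], which is 0 since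
   [qlpoly p] divides [v j]. *)
have e0 : \sum_r c r *: e r = 0.
  apply/rowP => j; rewrite summxE mxE.
  apply: (mulfI (mulf_neq0 g'0 g0)); rewrite mulr0.
  transitivity (ev (v j)); last exact/(evP (vhom j)).
  rewrite [RHS](raddf_sum (mmap iota t)) big_distrr; apply: eq_bigr => r _ /=.
  rewrite mxE (fE (r, j)) gaE rmorphM /= -/ev.
  by rewrite mulrACA ![_ * (_ / _)]mulrC !divfK.
by have /freeP freeU := basis_free (vbasisP U); exact: freeU e0.
Qed.

End Multipliers.

(** * Fields between K^2 and K, and divisibility by quasi-Pfister forms *)

Section Divisibility.
Variable K : fieldType.
Hypothesis char2 : 2%N \in [pchar K].
Implicit Types (phi psi pi r P Q : qlform K) (G : K -> Prop).

Let qlvalue_sub phi psi : (forall a, a \in phi -> qlvalue psi a) ->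
  forall x, qlvalue phi x -> qlvalue psi x.
Proof. exact: qlvalue_min (qlvalue_subspace char2 psi). Qed.

(** Closure under inverses follows from x^-1 = (x^-1)^2 x, as K^2 acts on [G]. *)
Definition sq_subfield G : Prop :=
  [/\ sq_subspace G, G 1 & forall x y, G x -> G y -> G (x * y)].

Lemma sq_subfieldV G x : sq_subfield G -> G x -> G x^-1.
Proof.
move=> [[G0 _ GZ] _ _] Gx; have [->|x0] := eqVneq x 0; first by rewrite invr0.
by have := GZ x^-1 _ Gx; rewrite expr2 -mulrA mulVf // mulr1.
Qed.

(** The anisotropic part of [psi] has at least the dimension of [phi], which leaves no room for
    isotropic vectors. *)
Lemma anisotropic_of_size phi psi : anisotropic phi ->
  (forall x, qlvalue phi x -> qlvalue psi x) -> (size psi <= size phi)%N ->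
  anisotropic psi.
Proof.
move=> phi_an sub le [v v0 vE].
have : (size phi <= size (anisotropic_part psi))%N.
  apply: (anisotropic_leq_size char2) => // a /mem_qlvalue/sub.
  by move/(qlvalue_anisotropic_part char2).
have [U UE] := isotropic_vspace char2 psi.
have : (0 < \dim U)%N.
  rewrite lt0n dimv_eq0; apply: contraNneq v0 => U0.
  by rewrite -memv0 -U0 UE vE.
rewrite -(iso_indexE UE); have := size_anisotropic_part char2 psi.
lia.
Qed.

Lemma qlvalue_tensor_cons a r pi x : qlvalue (tensor (a :: r) pi) x <->
  exists y z, [/\ qlvalue pi y, qlvalue (tensor r pi) z & x = a * y + z].
Proof.
split=> [/(qlvalue_cat char2)[_ [z [/(qlvalue_scale char2)[y vy ->] vz ->]]]|].
  by exists y, z.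
move=> [y [z [vy vz ->]]]; apply/(qlvalue_cat char2); exists (a * y), z; split=> //.
by apply/(qlvalue_scale char2); exists y.
Qed.

Lemma qlvalue_tensorM r pi y z : sq_subfield (qlvalue pi) ->
  qlvalue pi y -> qlvalue (tensor r pi) z -> qlvalue (tensor r pi) (y * z).
Proof.
move=> [_ _ piM] vy; elim: r z => [z /qlvalue_nil ->|a r IH z].
  by rewrite mulr0; apply/qlvalue_nil.
move=> /qlvalue_tensor_cons[u [w [vu vw ->]]]; apply/qlvalue_tensor_cons.
by exists (y * u), (y * w); rewrite mulrDr mulrCA; split; [exact: piM | exact: IH |].
Qed.

(** The new block a D([pi]) meets the old values only in 0: since D([pi]) is a field acting on them,
    a common nonzero element [a * y] would give [a] itself. *)
Lemma anisotropic_tensor_cons a r pi : sq_subfield (qlvalue pi) ->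
  anisotropic pi -> anisotropic (tensor r pi) -> ~ qlvalue (tensor r pi) a ->
  anisotropic (tensor (a :: r) pi).
Proof.
move=> piF pi_an r_an nra; have a0 : a != 0.
  by apply: contra_notN nra => /eqP ->; exact: qlvalue0.
apply: (anisotropic_cat char2) => //; first exact: anisotropic_scale.
move=> _ /(qlvalue_scale char2)[y vy ->] vay.
have [->|y0] := eqVneq y 0; first by rewrite mulr0.
case: nra; have -> : a = y^-1 * (a * y) by rewrite mulrC mulfK.
by apply: qlvalue_tensorM => //; exact: sq_subfieldV.
Qed.

Lemma qlvalue_one x : qlvalue ([:: 1] : qlform K) x <-> exists c, x = c ^+ 2.
Proof.
split=> [/qlvalue_cons[c [_ [/qlvalue_nil -> ->]]]|[c ->]].
  by exists c; rewrite mul1r addr0.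
by apply/qlvalue_cons; exists c, 0; rewrite mul1r addr0; split=> //; exact: qlvalue0.
Qed.

Lemma qlvalue_pfister_step a pi x : qlvalue (tensor [:: 1; a] pi) x <->
  exists y z, [/\ qlvalue pi y, qlvalue pi z & x = y + a * z].
Proof.
split=> [/qlvalue_tensor_cons[y [_ [vy /qlvalue_tensor_cons[z [_ [vz /qlvalue_nil -> ->]]] ->]]]|].
  by exists y, z; rewrite mul1r addr0.
move=> [y [z [vy vz ->]]]; apply/qlvalue_tensor_cons; exists y, (a * z).
split=> //; last by rewrite mul1r.
by apply/qlvalue_tensor_cons; exists z, 0; rewrite addr0; split=> //; exact: qlvalue0.
Qed.

(** The value set is K^2(a_1, ..., a_s): in (y + a z)(y' + a z') the term a^2 z z' returns to the
    smaller field. *)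
Lemma quasi_pfister_subfield (s : seq K) : sq_subfield (qlvalue (quasi_pfister s)).
Proof.
elim: s => [|a s [piS pi1 piM]] /=; split; try exact: qlvalue_subspace.
- by apply: mem_qlvalue; rewrite mem_head.
- move=> _ _ /qlvalue_one[c ->] /qlvalue_one[d ->].
  by apply/qlvalue_one; exists (c * d); rewrite exprMn.
- apply/qlvalue_pfister_step; exists 1, 0; rewrite mulr0 addr0.
  by split=> //; exact: qlvalue0.
- move=> _ _ /qlvalue_pfister_step[y [z [vy vz ->]]]
    /qlvalue_pfister_step[y' [z' [vy' vz' ->]]]; apply/qlvalue_pfister_step.
  exists (y * y' + a ^+ 2 * (z * z')), (y * z' + z * y'); split; last by ring.
    by apply: (qlvalueD char2); [exact: piM | apply: qlvalueZ; exact: piM].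
  by apply: (qlvalueD char2); exact: piM.
Qed.

Lemma size_quasi_pfister (s : seq K) : size (quasi_pfister s) = (2 ^ size s)%N.
Proof. by elim: s => //= a s IH; rewrite !size_cat !size_map IH addn0 expnS mul2n addnn. Qed.

Lemma quasi_pfister_sub (s : seq K) G : sq_subfield G ->
  (forall a, a \in s -> G a) -> forall x, qlvalue (quasi_pfister s) x -> G x.
Proof.
move=> [[G0 GD GZ] G1 GM]; elim: s => [_ _ /qlvalue_one[c ->]|a s IH sG x] /=.
  by rewrite -[_ ^+ 2]mulr1; exact: GZ.
have Gs y : qlvalue (quasi_pfister s) y -> G y.
  by apply: IH => b bs; apply: sG; rewrite inE bs orbT.
move=> /qlvalue_pfister_step[y [z [/Gs Gy /Gs Gz ->]]].
by apply: GD => //; apply: GM => //; apply: sG; rewrite mem_head.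
Qed.

(** A longest sequence in [G] with anisotropic quasi-Pfister form generates [G] over K^2, because
    any element outside its value set would extend it. The bound [N] ensures that such a sequence
    exists. *)
Lemma quasi_pfister_values G N : sq_subfield G ->
  (forall phi, anisotropic phi -> (forall a, a \in phi -> G a) -> (size phi <= N)%N) ->
  exists s pi, [/\ is_quasi_pfister s pi, anisotropic pi
    & forall x, qlvalue pi x <-> G x].
Proof.
move=> GF bound.
pose T k := `[< exists a : seq K, [/\ size a = k, forall b, b \in a -> b != 0 /\ G b
  & anisotropic (quasi_pfister a)] >].
have T0 : exists k, T k.
  exists 0%N; apply/asboolP; exists [::]; split=> //.
  apply: (anisotropic_cons char2); first exact: anisotropic_nil.
  by move=> /qlvalue_nil/eqP; rewrite oner_eq0.
have Tub k : T k -> (k <= N)%N.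
  move=> /asboolP[a [<- aG /bound le]]; apply: leq_trans (le _); last first.
    by move=> b /mem_qlvalue; apply: quasi_pfister_sub => // c /aG[].
  by rewrite size_quasi_pfister ltnW // ltn_expl.
case: (ex_maxnP T0 Tub) => k /asboolP[a [ak aG a_an]] kmax.
exists k, (quasi_pfister a); split=> // [|x].
  exists (tcast ak (in_tuple a)); last by rewrite val_tcast.
  move=> i; case: (aG (tnth (tcast ak (in_tuple a)) i)) => //.
  by rewrite -[a in _ \in a](val_tcast ak (in_tuple a)) mem_tnth.
have aF := quasi_pfister_subfield a.
split; first by apply: quasi_pfister_sub => // c /aG[].
move=> Gx; apply: contrapT => nx.
have x0 : x != 0 by apply: contra_notN nx => /eqP ->; exact: qlvalue0.
suff : T k.+1 by move/kmax; rewrite ltnn.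
apply/asboolP; exists (x :: a); split=> [||/=]; first by rewrite /= ak.
  by move=> b; rewrite inE => /predU1P[-> //|/aG].
apply: anisotropic_tensor_cons => //.
  apply: anisotropic_tensor_cons => //; first exact: anisotropic_nil.
  by move=> /qlvalue_nil/eqP; rewrite (negPf x0).
(* If 1 were in x D([quasi_pfister a]), then [x] would be the inverse of a value, hence a value. *)
move=> /qlvalue_tensor_cons[y [_ [vy /qlvalue_nil -> E]]]; apply: nx.
have y0 : y != 0.
  by apply/eqP => y0; move/eqP: E; rewrite y0 mulr0 addr0 oner_eq0.
have -> : x = y^-1 by apply: (mulIf y0); rewrite mulVf // E addr0.
exact: sq_subfieldV.
Qed.

(** D([psi]) is a vector space over the field D([pi]); a maximal independent sequence [r] is a
    basis, so [psi] and the product of [pi] and [r] have the same values. *)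
Lemma divisible_of_values psi pi : anisotropic psi -> anisotropic pi ->
  sq_subfield (qlvalue pi) ->
  (forall y w, qlvalue pi y -> qlvalue psi w -> qlvalue psi (y * w)) ->
  divisible psi pi.
Proof.
move=> psi_an pi_an piF psiM.
have pi_gt0 : (0 < size pi)%N.
  move: piF; case: (pi) => // -[_ /qlvalue_nil/eqP]; by rewrite oner_eq0.
pose T k := `[< exists r, [/\ size r = k, anisotropic (tensor r pi)
  & forall x, qlvalue (tensor r pi) x -> qlvalue psi x] >].
have T0 : exists k, T k.
  exists 0%N; apply/asboolP; exists [::]; split=> //; first exact: anisotropic_nil.
  by move=> x /qlvalue_nil ->; exact: qlvalue0.
have Tub k : T k -> (k <= size psi)%N.
  move=> /asboolP[r [<- r_an sub]]; apply: (@leq_trans (size (tensor r pi))).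
    by rewrite size_allpairs leq_pmulr.
  by apply: (anisotropic_leq_size char2) => // a /mem_qlvalue/sub.
case: (ex_maxnP T0 Tub) => k /asboolP[r [rk r_an sub]] kmax.
(* The construction appends blocks to [tensor r pi], while [divisible] has the factors in the other
   order; both have the same coefficients and size, hence the same values and anisotropy. *)
have memC : tensor pi r =i tensor r pi.
  by move=> x; apply/allpairsP/allpairsP => -[[a b] /= [ia ib ->]];
    exists (b, a); rewrite mulrC.
have valC x : qlvalue (tensor r pi) x <-> qlvalue (tensor pi r) x.
  by split; apply: qlvalue_sub => a /=; rewrite ?memC; [rewrite -memC|]; exact: mem_qlvalue.
exists r; apply: (anisotropic_isometric char2) => //.
  apply: (anisotropic_of_size r_an) => [x /valC //|].
  by rewrite !size_allpairs mulnC.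
move=> x; split=> [vx|/valC/sub //]; apply/valC.
apply: contrapT => nx; suff : T k.+1 by move/kmax; rewrite ltnn.
apply/asboolP; exists (x :: r); split; first by rewrite /= rk.
  exact: anisotropic_tensor_cons.
move=> _ /qlvalue_tensor_cons[y [z [vy /sub vz ->]]].
by apply: (qlvalueD char2) => //; rewrite mulrC; exact: psiM.
Qed.

(** * The field of multipliers of a value set *)

Definition multiplier P g : Prop := forall w, qlvalue P w -> qlvalue P (g * w).

Lemma multiplier_subfield P : sq_subfield (multiplier P).
Proof.
split=> [|w vw|x y Px Py w vw]; [|by rewrite mul1r|by rewrite -mulrA; apply/Px/Py].
split=> [w _|x y Px Py w vw|c x Px w vw].
- by rewrite mul0r; exact: qlvalue0.
- by rewrite mulrDl; apply: (qlvalueD char2); [exact: Px | exact: Py].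
- by rewrite -mulrA; apply: qlvalueZ; exact: Px.
Qed.

(* If [w] is a value of [P] with [u w] outside [u_1 D(P)], then
   [u_1 D(P) + u w G] is a direct sum inside [D(Q)], with [G] the field of
   multipliers of [D(P)], and its dimension exceeds that of [D(Q)]. *)
Lemma multiplier_quotients P Q (us vs : seq K) :
  (forall a u, u \in vs -> a \in P -> qlvalue P (u * a)) ->
  anisotropic vs -> size vs = iso_index P ->
  (forall a u, u \in us -> a \in P -> qlvalue Q (u * a)) ->
  anisotropic us -> (size Q < size P + iso_index Q)%N ->
  exists ws, [/\ size ws = size us, anisotropic ws
    & forall w, w \in ws -> multiplier P w].
Proof.
move=> vsP vs_an sz_vs usQ us_an lt.
case: us usQ us_an => [|u1 us] usQ us_an; first by exists [::].
have ext (R : qlform K) u : (forall a, a \in P -> qlvalue R (u * a)) ->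
    forall w, qlvalue P w -> qlvalue R (u * w).
  move=> uR w vw; apply: (qlvalue_sub (phi := map ( *%R u) P)).
    by move=> _ /mapP[a aP ->]; exact: uR.
  by apply/(qlvalue_scale char2); exists w.
have vsG v : v \in vs -> multiplier P v by move=> iv; apply: ext => a; exact: vsP.
have usE u w : u \in u1 :: us -> qlvalue P w -> qlvalue Q (u * w).
  by move=> iu; apply: ext => a; exact: usQ.
have u10 : u1 != 0.
  have /(anisotropic_consP char2)[_ nu] := us_an.
  by apply: contra_notN nu => /eqP ->; exact: qlvalue0.
exists (map ( *%R u1^-1) (u1 :: us)); split.
- by rewrite size_map.
- by apply: anisotropic_scale => //; rewrite invr_eq0.
move=> _ /mapP[u iu ->] w vw; apply: contrapT; rewrite -mulrA => nP.
pose P1 := anisotropic_part P; pose Q1 := anisotropic_part Q.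
have s0 : u * w != 0.
  by apply: contra_notN nP => /eqP ->; rewrite mulr0; exact: qlvalue0.
(* The field of multipliers enters through the span of [vs]: its [iso_index P] independent elements
   raise the total dimension to that of [P]. *)
have dir_an : anisotropic (map ( *%R u1) P1 ++ map ( *%R (u * w)) vs).
  apply: (anisotropic_cat char2).
  - by apply: anisotropic_scale => //; exact: anisotropic_part_anisotropic.
  - exact: anisotropic_scale.
  - move=> _ /(qlvalue_scale char2)[y /(qlvalue_anisotropic_part char2) vy ->].
    move=> /(qlvalue_scale char2)[g vg yg]; have Gg : multiplier P g.
      by move: vg; apply: qlvalue_min => //; case: (multiplier_subfield P).
    have [g0|g0] := eqVneq g 0; first by rewrite yg g0 mulr0.
    case: nP; have -> : u1^-1 * (u * w) = g^-1 * y.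
      by apply: (mulfI u10); rewrite mulVKf // [RHS]mulrCA yg [RHS]mulrC mulfK.
    exact: (sq_subfieldV (multiplier_subfield P) Gg) _ vy.
(* The direct sum has dimension [size P] and lies in D([Q]), whose dimension is
   [size Q - iso_index Q], less than [size P]. *)
have := anisotropic_leq_size char2 (psi := Q1) dir_an.
rewrite size_cat !size_map sz_vs size_anisotropic_part // => le.
have := size_anisotropic_part char2 Q; rewrite -/Q1.
suff : (size P <= size Q1)%N by lia.
apply: le => a; rewrite mem_cat => /orP[] /mapP[b ib ->];
  apply/(qlvalue_anisotropic_part char2).
  apply: usE; first by rewrite mem_head.
  by apply/(qlvalue_anisotropic_part char2)/mem_qlvalue.
by rewrite -mulrA; apply: usE => //; rewrite mulrC; exact: vsG.
Qed.

(** A nonzero value [w] embeds the field of multipliers into D([P]), which bounds its degree over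
    K^2. The form [pi] is chosen before [psi], so that it divides every anisotropic form with the
    values of [P]. *)
Lemma divisible_anisotropic_part P ws : (exists2 w, qlvalue P w & w != 0) ->
  anisotropic ws -> (forall w, w \in ws -> multiplier P w) ->
  exists s pi, [/\ is_quasi_pfister s pi,
    (forall psi, anisotropic psi -> (forall x, qlvalue psi x <-> qlvalue P x) ->
       divisible psi pi)
    & (size ws <= 2 ^ s /\ 2 ^ s <= size (anisotropic_part P))%N].
Proof.
move=> [w vw w0] ws_an wsG.
have GF := multiplier_subfield P.
have bound phi : anisotropic phi -> (forall a, a \in phi -> multiplier P a) ->
    (size phi <= size (anisotropic_part P))%N.
  move=> phi_an phiG; rewrite -(size_map ( *%R w)).
  apply: (anisotropic_leq_size char2); first exact: anisotropic_scale.
  move=> _ /mapP[a /phiG Ga ->]; apply/(qlvalue_anisotropic_part char2).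
  by rewrite mulrC; exact: Ga.
have [s [pi [pi_qp pi_an piE]]] := quasi_pfister_values GF bound.
have sz_pi : size pi = (2 ^ s)%N.
  by case: pi_qp => a _ ->; rewrite size_quasi_pfister size_tuple.
exists s, pi; split=> //; last first.
  rewrite -sz_pi; split; last by apply: bound => // a /mem_qlvalue/piE.
  by apply: (anisotropic_leq_size char2) => // a /wsG/piE.
move=> psi psi_an psiE; apply: divisible_of_values => //.
  by case: pi_qp => a _ ->; exact: quasi_pfister_subfield.
by move=> y v /piE Gy /psiE vv; apply/psiE/Gy.
Qed.

End Divisibility.

Theorem theorem6p17 (F : fieldType) (p q : qlform F)
    (K : fieldType) (iota : {rmorphism F -> K})
    (char2 : 2%N \in [pchar F])
    (p_aniso : anisotropic p) (q_aniso : anisotropic q)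
    (dim_p : (2 <= qldim p)%N) (dim_q : (2 <= qldim q)%N)
    (KP : is_function_field p iota)
    (q_iso : isotropic (base_change iota q))
    (index_gt : (qldim q)%:Z - (qldim p)%:Z
                < (iso_index (base_change iota q))%:Z) :
  (iso_index (base_change iota q) <= 2 ^ div_index1 iota p)%N /\
  exists (s : nat) (pi : qlform K),
    [/\ is_quasi_pfister s pi, divisible (form1 iota p) pi
      & (iso_index (base_change iota q) <= qldim pi)%N].
Proof.
have Kchar2 : 2%N \in [pchar K] by exact: rmorph_pchar iota _ char2.
have p_gt0 : (0 < qldim p)%N by exact: ltnW.
have P0 := qlpoly_neq0 char2 p_aniso p_gt0.
have [t tP] := function_field_generic_point p_gt0 KP.
have [vs [sz_vs vs_an vsP]] := isotropic_multipliers char2 tP p_aniso P0.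
have [us [sz_us us_an usQ]] := isotropic_multipliers char2 tP q_aniso P0.
set P := base_change iota p in vsP *; set Q := base_change iota q in usQ *.
have vsP' a u : u \in vs -> a \in P -> qlvalue P (u * a).
  by move=> iu /mapP[b ib ->]; exact: vsP.
have usQ' a u : u \in us -> a \in P -> qlvalue Q (u * a).
  by move=> iu /mapP[b ib ->]; exact: usQ.
have lt : (size Q < size P + iso_index Q)%N.
  by rewrite !size_map; move: index_gt; rewrite -/Q /qldim; lia.
have [ws [sz_ws ws_an wsG]] :=
  multiplier_quotients Kchar2 vsP' vs_an sz_vs usQ' us_an lt.
have P_neq0 : exists2 w, qlvalue P w & w != 0.
  exists (iota (nth 0 p 0)); first by apply: mem_qlvalue; apply: map_f; exact: mem_nth.
  rewrite fmorph_eq0; apply/eqP => p0.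
  have [a [r pE]] : exists a r, p = a :: r by case: (p) p_gt0 => // a r; exists a, r.
  move: p_aniso p0; rewrite pE => /(anisotropic_consP char2)[_ na] /= a0.
  by apply: na; rewrite a0; exact: qlvalue0.
have [s [pi [pi_qp div_pi [le_ws le_s]]]] :=
  divisible_anisotropic_part Kchar2 P_neq0 ws_an wsG.
rewrite sz_ws sz_us in le_ws.
have form1E x : qlvalue (form1 iota p) x <-> qlvalue P x.
  exact: qlvalue_anisotropic_part.
have sz_pi : size pi = (2 ^ s)%N.
  by case: pi_qp => a _ ->; rewrite size_quasi_pfister size_tuple.
split.
  apply: leq_trans le_ws _; rewrite leq_exp2l //.
  (* [div_index] is a maximum over a bounded range, which contains [s] because s < 2^s and 2^s is at
     most the dimension of [form1 iota p]. *)
  have lt_s : (s < (qldim (form1 iota p)).+1)%N.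
    by rewrite ltnS (leq_trans _ le_s) // ltnW // ltn_expl.
  apply: (@leq_bigmax_cond _ _ _ (Ordinal lt_s)); apply/asboolP; exists pi => //.
  (* [div_index] passes to the anisotropic part of [form1 iota p], again an anisotropic form with
     the values of [P]. *)
  apply: div_pi; first exact: anisotropic_part_anisotropic.
  by move=> x; apply: iff_trans (form1E x); exact: qlvalue_anisotropic_part.
exists s, pi; split=> //; last by rewrite /qldim sz_pi.
by apply: div_pi => //; exact: anisotropic_part_anisotropic.
Qed.
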